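(* Let $K$ be a non-empty compact metric space and let $A\subset[0,\dim_P K]$ be analytic. Then there is a compact set $\mathcal{C}\subset\mathcal{K}(K)$ with $\{\dim_P C: C\in\mathcal{C}\}=A$.
   Context: $\mathcal{K}(K)$ denotes the set of non-empty compact subsets of $K$ endowed with the Hausdorff metric; the family $\mathcal{C}$ may be empty. For a metric space $X$ let $N_n(X)$ be the minimal number of closed balls of radius at most $2^{-n}$ needed to cover $X$, and $\overline{\dim}_B\,X=\limsup_{n\to\infty}\frac{\log N_n(X)}{n\log 2}$. The packing dimension is $\dim_P X=\inf\{\sup_i\overline{\dim}_B\,E_i: X=\bigcup_{i=1}^\infty E_i\}$ (it may be $+\infty$, in which case the interval $[0,\dim_P K]$ is taken in the extended reals). A set $A$ is analytic if it is the image of a (possibly empty) Polish space under a continuous map; in particular $\emptyset$ is analytic. *)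

(* Defs.v *)
From HB Require Import structures.
From mathcomp Require Import all_boot all_order all_algebra.
From mathcomp Require Import all_classical all_reals all_analysis.

Set Implicit Arguments.
Unset Strict Implicit.
Unset Printing Implicit Defensive.

Import Order.TTheory GRing.Theory Num.Theory.
Import numFieldNormedType.Exports.

Local Open Scope classical_set_scope.
Local Open Scope ring_scope.

Section hausdorff_metric.
Context {R : realType} {K : metricType R}.
Implicit Types A B C : set K.

Definition hausdorff_radii A B : set R := [set e : R | [/\ 0 < e,
  A `<=` \bigcup_(b in B) ball b e & B `<=` \bigcup_(a in A) ball a e]].

Definition hausdorff_dist A B : R := inf (hausdorff_radii A B).

Lemma hausdorff_radiiC A B : hausdorff_radii A B = hausdorff_radii B A.
Proof. by apply/seteqP; split => e [? ? ?]; split. Qed.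

Lemma hausdorff_radii_lb A B : lbound (hausdorff_radii A B) 0.
Proof. by move=> e [/ltW]. Qed.

Lemma compact_subset_ball A (x : K) : compact A ->
  exists2 e : R, 0 < e & A `<=` ball x e.
Proof.
move=> /compact_near_coveringP/(_ R (pinfty_nbhs R) (fun e y => ball x e y) _) cA.
have /cA : forall y, A y -> \forall y' \near y & e \near +oo, ball x e y'.
  move=> y _; exists (ball y 1, [set e | mdist x y + 1 < e]) => /=.
    by split; [exact: nbhsx_ballx|apply: nbhs_pinfty_gt; rewrite num_real].
  move=> [y' e]/= [+ +]; rewrite !ballEmdist/= => yy' xye.
  apply: (le_lt_trans (metric_triangle _ y _)).
  by rewrite (lt_trans _ xye)// ltrD2l.
move=> Ax; near (pinfty_nbhs R) => e; exists e; first by near: e; exact: nbhs_pinfty_gt.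
by near: e.
Unshelve. all: by end_near. Qed.

Lemma hausdorff_radii_nonempty A B : A !=set0 -> B !=set0 ->
  compact A -> compact B -> hausdorff_radii A B !=set0.
Proof.
move=> [a Aa] [b Bb] cA cB.
have [e e0 Ae] := compact_subset_ball b cA.
have [d d0 Bd] := compact_subset_ball a cB.
exists (e + d); split; first exact: addr_gt0.
- move=> x /Ae bx; exists b => //; apply: le_ball bx.
  by rewrite lerDl ltW.
- move=> x /Bd bx; exists a => //; apply: le_ball bx.
  by rewrite lerDr ltW.
Qed.

Lemma hausdorff_distxx A : hausdorff_dist A A = 0.
Proof.
have r e : 0 < e -> hausdorff_radii A A e.
  by move=> e0; split => // x Ax; exists x => //; exact: ballxx.
apply/eqP; rewrite eq_le; apply/andP; split.
  apply/ler_addgt0Pl => e e0; rewrite addr0.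
  by apply: ge_inf; [exists 0; exact: hausdorff_radii_lb|exact: r].
by apply: lb_le_inf; [exists 1; exact: r|exact: hausdorff_radii_lb].
Qed.

Lemma hausdorff_distC A B : hausdorff_dist A B = hausdorff_dist B A.
Proof. by rewrite /hausdorff_dist hausdorff_radiiC. Qed.

Lemma hausdorff_dist0_sub A B : A !=set0 -> B !=set0 ->
  compact A -> compact B -> hausdorff_dist A B = 0 -> A `<=` B.
Proof.
move=> A0 B0 cA cB AB0 x Ax.
have : closed B by apply: compact_closed => //; exact: metric_hausdorff.
apply => V /nbhs_ballP[e /= e0 xeV].
have hi : has_inf (hausdorff_radii A B).
  by split; [exact: hausdorff_radii_nonempty|exists 0; exact: hausdorff_radii_lb].
have [d [d0 AB _]] := inf_adherent e0 hi.
rewrite [inf _]AB0 add0r => de.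
have [b Bb bx] := AB x Ax; exists b; split => //; apply: xeV.
by apply: ball_sym; apply: le_ball bx; exact: ltW.
Qed.

Lemma hausdorff_dist_triangle B A C : A !=set0 -> B !=set0 -> C !=set0 ->
  compact A -> compact B -> compact C ->
  hausdorff_dist A C <= hausdorff_dist A B + hausdorff_dist B C.
Proof.
move=> A0 B0 C0 cA cB cC.
rewrite -lerBlDr; apply: lb_le_inf; first exact: hausdorff_radii_nonempty.
move=> e [e0 ABe BAe]; rewrite lerBlDr -lerBlDl.
apply: lb_le_inf; first exact: hausdorff_radii_nonempty.
move=> d [d0 BCd CBd]; rewrite lerBlDl.
apply: ge_inf; first by exists 0; exact: hausdorff_radii_lb.
split; first exact: addr_gt0.
- move=> x /ABe[y /BCd[z Cz zy] yx]; exists z => //.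
  by rewrite addrC; exact: ball_triangle zy yx.
- move=> x /CBd[y /BAe[z Cz zy] yx]; exists z => //.
  exact: ball_triangle zy yx.
Qed.

End hausdorff_metric.

(* An element of [hyperspace K] is a pair of a set and a proof;
   [set_val] recovers the underlying subset of K. *)
Definition hyperspace {R : realType} (K : metricType R) : Type :=
  [set C : set K | C !=set0 /\ compact C].

Section hyperspace_metric.
Context {R : realType} {K : metricType R}.
Implicit Types A B C : hyperspace K.

HB.instance Definition _ := Choice.on (hyperspace K).

Lemma hyperspaceP C : (set_val C : set K) !=set0 /\ compact (set_val C : set K).
Proof. exact: set_mem (valP C). Qed.

Let mdist A B : R := hausdorff_dist (set_val A) (set_val B).

Let mdistxx A : mdist A A = 0.
Proof. exact: hausdorff_distxx. Qed.

Let mdist_positivity A B : mdist A B = 0 -> A = B.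
Proof.
have [A0 cA] := hyperspaceP A; have [B0 cB] := hyperspaceP B => AB0.
apply: val_inj; apply/seteqP; split; first exact: hausdorff_dist0_sub.
by apply: hausdorff_dist0_sub => //; rewrite hausdorff_distC.
Qed.

Let mdist_sym A B : mdist A B = mdist B A.
Proof. exact: hausdorff_distC. Qed.

Let mdist_triangle B A C : mdist A C <= mdist A B + mdist B C.
Proof.
have [? ?] := hyperspaceP A; have [? ?] := hyperspaceP B.
by have [? ?] := hyperspaceP C; exact: hausdorff_dist_triangle.
Qed.

HB.instance Definition _ := isMetric.Build R (hyperspace K)
  mdistxx mdist_positivity mdist_sym mdist_triangle.

End hyperspace_metric.

Section packing_dimension.
Context {R : realType} {K : metricType R}.
Implicit Types E : set K.

(* A subset E of K is measured as a metric space in its own right, so the balls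
   are centered in E. They are sets {y | mdist x y <= r}: the library's
   [closed_ball], the closure of an open ball, may be smaller. *)
Definition ball_cover E (n m : nat) : Prop :=
  exists (x : 'I_m -> K) (r : 'I_m -> R),
    (forall i, [/\ E (x i), 0 < r i & r i <= 2 ^- n]) /\
    E `<=` \bigcup_i [set y | mdist (x i) y <= r i].

(* +oo when E has no finite cover *)
Definition covering_number E (n : nat) : \bar R :=
  ereal_inf [set m%:R%:E | m in ball_cover E n].

(* The value at n = 0 does not affect the limsup. *)
Definition upper_box_dim E : \bar R :=
  limn_esup (fun n : nat =>
    lne (covering_number E n) * ((n%:R * ln 2)^-1)%:E)%E.

Definition packing_dim E : \bar R :=
  ereal_inf [set ereal_sup (range (fun i => upper_box_dim (F i))) |
    F in [set F : (set K)^nat | E = \bigcup_i F i]].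

End packing_dimension.

(* Library structures of complete spaces are pointed, whereas a Polish space may
   be empty; hence completeness is spelled out. *)
Definition complete_separable {R : realType} (P : metricType R) : Prop :=
  (forall F : set_system P, ProperFilter F -> cauchy F -> exists x : P, F --> x) /\
  (exists2 D : set P, countable D & dense D).

(* Continuity only depends on the topology of the Polish space, so that space is
   given by any complete metric inducing its topology. *)
Definition analytic (R : realType) {T : topologicalType} (A : set T) : Prop :=
  exists (P : metricType R) (f : P -> T),
    [/\ complete_separable P, continuous f & range f = A].

(* Main.v *)
(* A set is [thin t] if its 2^-n-separated subsets eventually have at most
   2^(nt) points; dim_P E is the infimum of the t such that E is covered by
   countably many [thin t] sets.

   Suppose that dim_P B > b. Removing from B the points with a relative
   neighbourhood covered by countably many [thin b] sets leaves a nonempty Q all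
   of whose relatively open parts fail to be [thin b]. For a sequence T in [0, b],
   start with a point of Q and, at step k, add around every point constructed so
   far a finite subset of Q, far smaller than all previous scales, that has about
   2^(n T_k) points which are 2^-n-separated for one n, and not more than
   2^(j T_k) + 1 points which are 2^-j-separated for the others. The closure of
   all points has packing dimension limsup T: the upper bound is a count, the
   lower bound is Baire's theorem. It depends continuously on T.

   If A = f(P) with P Polish and a belongs to A, mark positions in a binary
   sequence to spell a fast Cauchy sequence p_n of points of P, and let T_k be
   f(p_k) at marked positions and a elsewhere, or once the Cauchy condition has
   failed. The upper limits are then exactly the elements of A in [a, b], so the
   Cantor space yields a compact family for this slice of A, inside any ball of
   large dimension.

   Countably many slices exhaust A minus {dim_P K}. Some point y has all its balls
   of packing dimension dim_P K. The n-th family is put in the ball of radius 2^-n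
   about y, and to its members are added y and a finite 2^-n-net of one fixed
   compact set D with dim_P D in A. Finite sets do not change the dimension, and
   the families converge to D together with y, so that their union with this limit
   is compact. If dim_P K is in A, the set K itself is added. *)
Require Import Defs.
From mathcomp Require Import all_boot all_order all_algebra.
From mathcomp Require Import all_classical all_reals all_analysis.
From mathcomp Require Import lra.

Set Implicit Arguments.
Unset Strict Implicit.
Unset Printing Implicit Defensive.

Import Order.TTheory GRing.Theory Num.Theory.
Import numFieldNormedType.Exports.

Local Open Scope classical_set_scope.
Local Open Scope ring_scope.

(** * Powers of two, minima of finite lists, and codes of pairs *)

Section preliminaries.
Context {R : realType}.

Lemma exp2NS n : (2 ^- n.+1 + 2 ^- n.+1 = 2 ^- n :> R).
Proof. by rewrite exprS invfM [2^-1 * _]mulrC -splitr. Qed.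

Lemma exp2N_le m n : (n <= m)%N -> (2 ^- m <= 2 ^- n :> R).
Proof.
move=> nm; rewrite lef_pV2 ?posrE ?exprn_gt0// ler_eXn2l// ?ltr1n//.
Qed.

Lemma exp2N_gt0 n : (0 < 2 ^- n :> R).
Proof. by rewrite invr_gt0 exprn_gt0. Qed.

Lemma exp2N_lt (r : R) : 0 < r -> exists N : nat, forall n, (N <= n)%N -> 2 ^- n < r.
Proof.
move=> r0; exists (Num.truncn r^-1).+1 => n Nn.
rewrite -[r]invrK ltf_pV2 ?posrE ?exprn_gt0 ?invr_gt0//.
apply: (lt_le_trans (truncnS_gt _)).
by rewrite (le_trans (_ : _ <= n%:R)) ?ler_nat// -natrX ler_nat ltnW// ltn_expl.
Qed.

Lemma seq_gt0_lb (l : seq R) : {in l, forall x, 0 < x} ->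
  exists2 d, 0 < d & {in l, forall x, d <= x}.
Proof.
elim: l => [|a l IH] l0; first by exists 1.
have [d d0 dl] : exists2 d, 0 < d & {in l, forall x, d <= x}.
  by apply: IH => x xl; apply: l0; rewrite inE xl orbT.
exists (Num.min a d); first by rewrite lt_min d0 l0// mem_head.
move=> x /[1!inE] /predU1P[->|xl]; first by rewrite ge_min lexx.
by rewrite ge_min dl// orbT.
Qed.

End preliminaries.

Lemma pickle_unbounded (i N : nat) : exists z : nat, (N <= pickle (i, z))%N.
Proof.
apply: contrapT => nz.
have lt (z : nat) : (pickle (i, z) < N)%N.
  by rewrite ltnNge; apply/negP => h; apply: nz; exists z.
have : uniq [seq pickle (i, z) | z <- iota 0 N.+1].
  by rewrite map_inj_uniq ?iota_uniq// => z z' /(pcan_inj pickleK) [].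
move=> /(@uniq_leq_size _ _ (iota 0 N)); rewrite size_map !size_iota ltnn => h.
by apply/negP: isT; apply: h => _ /mapP[z _ ->]; rewrite mem_iota /=.
Qed.

(** * Countable covers by thin sets, and the packing dimension *)

Section thin.
Context {R : realType} {K : metricType R}.
Implicit Types (E F : set K) (t : R) (s : seq K).

Definition spaced (n : nat) s : Prop :=
  uniq s /\ {in s &, forall x y, x != y -> 2 ^- n < mdist x y}.

(** Counting spaced points instead of covering balls makes the notion monotone in [E], which
    covering numbers with centres in [E] are not. *)
Definition thin t E : Prop := exists N : nat, forall n s, (N <= n)%N ->
  {in s, forall x, E x} -> spaced n s -> (size s)%:R <= 2 `^ (n%:R * t).

Definition sthin t E : Prop :=
  exists F : (set K)^nat, (forall i, thin t (F i)) /\ E `<=` \bigcup_i F i.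

Lemma spaced_sub n s s' : uniq s' -> {subset s' <= s} ->
  spaced n s -> spaced n s'.
Proof.
move=> us' s's [us ss]; split => // x y xs ys; apply: ss; exact: s's.
Qed.

(** Two points in one ball of radius at most 2^-(n+1) are at distance at most 2^-n, so each ball
    holds at most one point of [s]. *)
Lemma spaced_size E n m s : ball_cover E n.+1 m -> {in s, forall x, E x} ->
  spaced n s -> (size s <= m)%N.
Proof.
move=> [x [r [xr cov]]] sE [us ss].
pose f y : option 'I_m := [pick i | mdist (x i) y <= r i].
have fs y : y \in s -> exists2 i, f y = Some i & mdist (x i) y <= r i.
  move=> ys; have [i _ /= iy] := cov _ (sE _ ys).
  by rewrite /f; case: pickP => [j jy|/(_ i)]; [exists j|rewrite iy].
have fi : {in s &, injective f}.
  move=> y z ys zs; have [i -> iy] := fs _ ys; have [j -> jz] := fs _ zs.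
  move=> [ij]; subst j; apply/eqP/negPn/negP => yz.
  have := ss _ _ ys zs yz; apply/negP; rewrite -leNgt.
  apply: (le_trans (metric_triangle _ (x i) _)).
  have [_ _ ri] := xr i.
  by rewrite -exp2NS lerD// ?(le_trans _ ri)// metric_sym.
have : uniq (map f s) by rewrite map_inj_in_uniq.
move=> /(@uniq_leq_size _ _ (map Some (enum 'I_m))).
rewrite 2!size_map size_enum_ord; apply => _ /mapP[y ys ->].
by have [i -> _] := fs _ ys; rewrite map_f// mem_enum.
Qed.

(** A spaced list of maximal length is a net: a point farther than 2^-n from all its members could
    be added. *)
Lemma spaced_max E n M :
  (forall s, {in s, forall x, E x} -> spaced n s -> (size s <= M)%N) ->
  exists s, [/\ {in s, forall x, E x}, spaced n s & ball_cover E n (size s)].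
Proof.
move=> bnd.
pose P m := `[< exists s, [/\ {in s, forall x, E x}, spaced n s & size s = m] >].
have exP : exists m, P m by exists 0; apply/asboolP; exists [::].
have ubP m : P m -> (m <= M)%N by move=> /asboolP[s [sE ss <-]]; exact: bnd.
case: (ex_maxnP exP ubP) => m /asboolP[s [sE ss sm]] max.
exists s; split => //.
exists (fun i => tnth (in_tuple s) i), (fun=> 2 ^- n); split.
  by move=> i; split; rewrite ?invr_gt0 ?exprn_gt0//; apply: sE; exact: mem_tnth.
move=> y Ey; apply: contrapT => ny.
have sy x : x \in s -> 2 ^- n < mdist x y.
  move=> /(tnthP (in_tuple s))[i xi]; rewrite ltNge; apply/negP => xy; apply: ny.
  by exists i => //=; rewrite -xi.
have : P m.+1.
  apply/asboolP; exists (y :: s); split; last by rewrite /= sm.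
    by move=> x /[1!inE] /predU1P[->|/sE].
  case: ss => us ss; split => /=.
    rewrite us andbT; apply/negP => /sy; rewrite mdistxx ltNge.
    by rewrite invr_ge0 exprn_ge0.
  move=> x z /[!inE] /predU1P[->|xs] /predU1P[->|zs]; rewrite ?eqxx//.
  - by rewrite metric_sym => _; exact: sy.
  - by move=> _; exact: sy.
  - exact: ss.
by move=> /max; rewrite ltnn.
Qed.

Lemma covering_numberP t E n : (0 < n)%N ->
  (lne (covering_number E n) * ((n%:R * ln 2)^-1)%:E <= t%:E)%E ->
  (covering_number E n <= (2 `^ (n%:R * t))%:E)%E.
Proof.
move=> n0; have ln20 : 0 < ln 2 :> R by rewrite ln_gt0// ltr1n.
have c0 : 0 < n%:R * ln 2 :> R by rewrite mulr_gt0// ltr0n.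
case: (covering_number E n) => [c| |]//=; last by rewrite leNye.
- case: ifPn => [c0' _|]; first by rewrite lee_fin (le_trans c0')// powR_ge0.
  rewrite -ltNge => cp; rewrite -EFinM !lee_fin ler_pdivrMr// => H.
  rewrite -ler_ln ?posrE ?powR_gt0// ln_powR.
  by rewrite (le_trans H)// mulrA [t * _]mulrC.
- by rewrite gt0_mulye ?lte_fin ?invr_gt0.
Qed.

Lemma le_lne_covering t E n : (0 < n)%N ->
  (covering_number E n <= (2 `^ (n%:R * t))%:E)%E ->
  (lne (covering_number E n) * ((n%:R * ln 2)^-1)%:E <= t%:E)%E.
Proof.
move=> n0; have ln20 : 0 < ln 2 :> R by rewrite ln_gt0// ltr1n.
have c0 : 0 < n%:R * ln 2 :> R by rewrite mulr_gt0// ltr0n.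
case: (covering_number E n) => [c| |]//=.
- case: ifPn => [c0' _|]; first by rewrite gt0_mulNye ?lte_fin ?invr_gt0// leNye.
  rewrite -ltNge => cp; rewrite -EFinM !lee_fin ler_pdivrMr// => H.
  move: H; rewrite -ler_ln ?posrE ?powR_gt0// ln_powR => H.
  by rewrite (le_trans H)// mulrA [t * _]mulrC.
- by rewrite gt0_mulNye ?lte_fin ?invr_gt0 ?leNye.
Qed.

Lemma thin_upper_box_dim t E : thin t E -> (upper_box_dim E <= t%:E)%E.
Proof.
move=> [N thE]; rewrite /upper_box_dim /limn_esup limf_esupE.
apply: le_trans (ereal_inf_lbound _) _.
  (* The tail starts at [N.+1], so that n is positive in the quotient by n ln 2. *)
  by exists [set k | (N.+1 <= k)%N] => //; exists N.+1.
apply: ge_ereal_sup => _ [n /= Nn <-].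
apply: le_lne_covering; first exact: leq_trans Nn.
have [s [sE ss cs]] : exists s,
    [/\ {in s, forall x, E x}, spaced n s & ball_cover E n (size s)].
  apply: (@spaced_max _ _ (Num.truncn (2 `^ (n%:R * t) : R))) => s sE ss.
  by rewrite truncn_ge_nat ?powR_ge0 ?thE// ltnW.
apply: le_trans (ereal_inf_lbound _) _; first by exists (size s).
by rewrite lee_fin thE// ltnW.
Qed.

Lemma upper_box_dim_thin t E : (upper_box_dim E < t%:E)%E -> thin t E.
Proof.
rewrite /upper_box_dim /limn_esup limf_esupE => /ereal_inf_lt[_ [V [N _ NV] <-]].
set sg := ereal_sup _ => sgt.
have [t' sgt' t't] : exists2 t', (sg <= t'%:E)%E & t' < t.
  move: sgt; case: sg => [x| |]//=; first by rewrite lte_fin => xt; exists x.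
  by move=> _; exists (t - 1); [rewrite leNye|rewrite ltrBlDr ltrDl].
(* For n >= |t'| / (t - t') one has (n + 1) t' <= n t, which pays for comparing spaced lists at n
   with covers at n + 1. *)
pose M := Num.truncn (`|t'| / (t - t')).
exists (maxn N M.+1) => n s; rewrite geq_max => /andP[Nn Mn] sE ss.
have : (covering_number E n.+1 <= (2 `^ (n.+1%:R * t'))%:E)%E.
  apply: covering_numberP => //; apply: le_trans sgt'.
  by apply: ereal_sup_ubound; exists n.+1 => //; apply: NV; exact: leqW.
have : ((size s)%:R%:E <= covering_number E n.+1)%E.
  apply: le_ereal_inf_tmp => _ [m cm <-]; rewrite lee_fin ler_nat.
  exact: spaced_size cm sE ss.
move=> /le_trans/[apply]; rewrite lee_fin => /le_trans; apply.
rewrite ler_powR ?ler1n// -natr1 mulrDl mul1r -lerBrDl -mulrBr.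
have : `|t'| / (t - t') < n%:R.
  by rewrite (lt_le_trans (truncnS_gt _))// ler_nat.
rewrite ltr_pdivrMr ?subr_gt0// => /ltW; apply: le_trans; exact: ler_norm.
Qed.

Lemma sub_thin t E F : E `<=` F -> thin t F -> thin t E.
Proof.
move=> EF [N thF]; exists N => n s Nn sE ss; apply: thF => // x xs.
by apply: EF; exact: sE.
Qed.

Lemma sub_sthin t E F : E `<=` F -> sthin t F -> sthin t E.
Proof.
by move=> EF [G [thG FG]]; exists G; split => //; exact: subset_trans FG.
Qed.

Lemma thin_sthin t E : thin t E -> sthin t E.
Proof. by move=> thE; exists (fun=> E); split => // x; exists 0. Qed.

Lemma sthin_bigcup t (F : (set K)^nat) :
  (forall i, sthin t (F i)) -> sthin t (\bigcup_i F i).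
Proof.
move=> /choice[G thG].
exists (fun n => if unpickle n is Some (i, j) then G i j else set0); split.
  move=> n; case: (unpickle _) => [[i j]|]; first by have [] := thG i.
  exists 0 => n' [|x s] _ s0 _; first by rewrite powR_ge0.
  by case: (s0 x); rewrite mem_head.
move=> x [i _ Fx]; have [j _ Gx] := (thG i).2 _ Fx.
by exists (pickle (i, j)) => //; rewrite pickleK.
Qed.

Lemma sthin_setU t E F : sthin t E -> sthin t F -> sthin t (E `|` F).
Proof.
move=> thE thF.
have : sthin t (\bigcup_i (if i is 0 then E else F)).
  by apply: sthin_bigcup => -[|i].
by apply: sub_sthin => x [Ex|Fx]; [exists 0|exists 1].
Qed.

Lemma sthin_set1 t (x : K) : 0 <= t -> sthin t [set x].
Proof.
move=> t0; apply: thin_sthin; exists 0 => n [|y [|z s]] _ sx [us _].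
- by rewrite powR_ge0.
- by rewrite -[leLHS](powRr0 2) ler_powR ?ler1n// mulr_ge0.
- move: us; rewrite /= inE.
  by rewrite (sx y) ?mem_head// (sx z) ?inE ?eqxx// orbT.
Qed.

Lemma sthin_seq t s : 0 <= t -> sthin t [set x | x \in s].
Proof.
move=> t0; elim: s => [|x s IH].
  apply: thin_sthin; exists 0 => n [|x s] _ s0 _; first by rewrite powR_ge0.
  by have := s0 x; rewrite mem_head => /(_ isT).
apply: sub_sthin (sthin_setU (sthin_set1 x t0) IH) => y /=.
by rewrite inE => /predU1P[->|]; [left|right].
Qed.

Lemma sthin_packing_dim t E : sthin t E -> (packing_dim E <= t%:E)%E.
Proof.
move=> [F [thF EF]].
apply: le_trans (ereal_inf_lbound _) _.
  exists (fun i => F i `&` E) => //=.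
  by rewrite -setI_bigcupl; apply/seteqP; split => [x Ex|x []//]; split => //; exact: EF.
apply: ge_ereal_sup => _ [i _ <-]; apply: thin_upper_box_dim.
exact: sub_thin (thF i).
Qed.

Lemma lte_EFin_split (x : \bar R) (a : R) : (x < a%:E)%E ->
  exists2 t, (x < t%:E)%E & t < a.
Proof.
case: x => [x| |]//=.
  by rewrite lte_fin => xa; exists ((x + a) / 2); rewrite ?lte_fin; lra.
by move=> _; exists (a - 1); [rewrite ltNyr|lra].
Qed.

Lemma thin_le t t' E : t <= t' -> thin t E -> thin t' E.
Proof.
move=> tt' [N thE]; exists N => n s Nn sE ss; apply: le_trans (thE n s Nn sE ss) _.
by rewrite ler_powR ?ler1n// ler_wpM2l.
Qed.

Lemma sthin_le t t' E : t <= t' -> sthin t E -> sthin t' E.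
Proof. by move=> tt' [F [thF EF]]; exists F; split => // i; exact: thin_le (thF i). Qed.

Lemma packing_dim_sthin t E : (packing_dim E < t%:E)%E -> sthin t E.
Proof.
move=> /ereal_inf_lt[_ [F /= -> <-]] Ft; exists F; split => // i.
apply: upper_box_dim_thin; apply: le_lt_trans Ft; apply: ereal_sup_ubound.
by exists i.
Qed.

End thin.

(** * Extraction of spaced sets, finite covers, and the core of a set *)

Section selection.
Context {R : realType} {K : metricType R}.
Implicit Types (E F B : set K) (t : R) (s : seq K).

(* Separation is a strict inequality, so it survives small perturbations. *)
Lemma thin_closure t E : thin t E -> thin t (closure E).
Proof.
move=> [N thE]; exists N => n s Nn sE [us ss].
(* [d] is a lower bound for the slack in the separation inequalities, so points moved by less than d
   / 2 stay separated. Diagonal pairs get the dummy value 1. *)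
have [d d0 dl] : exists2 d, 0 < d & {in s &, forall x y, x != y ->
    d <= mdist x y - 2 ^- n}.
  have [|d d0 dl] := @seq_gt0_lb R
    [seq (if x == y then 1 else mdist x y - 2 ^- n) | x <- s, y <- s].
    move=> _ /allpairsP[[x y] /= [xs ys ->]].
    by case: eqVneq => // xy; rewrite subr_gt0 ss.
  exists d => // x y xs ys xy.
  have := dl (if x == y then 1 else mdist x y - 2 ^- n).
  rewrite (negbTE xy); apply.
  by apply/allpairsP; exists (x, y); rewrite /= (negbTE xy).
have /choice[g gE] x : exists y, x \in s -> E y /\ mdist x y < d / 2.
  case: (boolP (x \in s)) => [xs|_]; last by exists x.
  have [|y [Ey]] := sE x xs (ball x (d / 2)); first by apply: nbhsx_ballx; rewrite divr_gt0.
  by rewrite ballEmdist => xy; exists y.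
have gs x y : x \in s -> y \in s -> x != y -> 2 ^- n < mdist (g x) (g y).
  move=> xs ys xy; have [_ gx] := gE _ xs; have [_ gy] := gE _ ys.
  have := dl _ _ xs ys xy; have := metric_triangle x (g x) y.
  have := metric_triangle (g x) (g y) y; rewrite (metric_sym (g y)).
  move=> *; lra.
rewrite -(size_map g); apply: thE => //.
  by move=> _ /mapP[x xs ->]; exact: (gE x xs).1.
split.
  rewrite map_inj_in_uniq// => x y xs ys gxy; apply/eqP/negPn/negP => xy.
  have := gs _ _ xs ys xy; rewrite gxy mdistxx ltNge.
  by rewrite invr_ge0 exprn_ge0.
move=> _ _ /mapP[x xs ->] /mapP[y ys ->] gxy; apply: gs => //.
by apply: contra gxy => /eqP ->.
Qed.

(* Among the spaced sets with more than [2 ^ (n t)] points, one of least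
   cardinality has few spaced points at all the other scales. *)
Lemma spaced_extract t b E m : t <= b -> ~ thin b E -> exists s,
  [/\ {in s, forall x, E x},
      forall j s', (m <= j)%N -> {subset s' <= s} -> spaced j s' ->
        (size s')%:R <= 2 `^ (j%:R * t) + 1 &
      exists2 n, (m <= n)%N & spaced n s /\ 2 `^ (n%:R * t) < (size s)%:R].
Proof.
move=> tb nthE.
pose P k := `[< exists s n, [/\ {in s, forall x, E x}, (m <= n)%N, spaced n s,
  2 `^ (n%:R * t) < (size s)%:R & size s = k] >].
have exP : exists k, P k.
  apply: contrapT => nP; apply: nthE; exists m => n s mn sE ss.
  rewrite leNgt; apply/negP => sn; apply: nP; exists (size s); apply/asboolP.
  exists s, n; split => //; apply: le_lt_trans sn.
  by rewrite ler_powR ?ler1n// ler_wpM2l.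
case: (ex_minnP exP) => k /asboolP[s [n [sE mn ss sn sk]]] kmin.
exists s; split => //; last by exists n.
(* If a list exceeded the bound, its tail would still have more than 2^(jt) points but fewer points
   than [s], against minimality; hence the + 1. *)
move=> j [|x s'] mj s's ss'; first by rewrite addr_ge0 ?powR_ge0.
rewrite /= -natr1 lerD2r leNgt; apply/negP => s'j.
have us' : uniq (x :: s') by case: ss'.
have /kmin : P (size s').
  apply/asboolP; exists s', j; split => //.
    by move=> y ys'; apply/sE/s's; rewrite inE ys' orbT.
  apply: spaced_sub ss'; first by case/andP: us'.
  by move=> y ys'; rewrite inE ys' orbT.
by rewrite -sk leqNgt; have /= -> := uniq_leq_size us' s's.
Qed.

(* [compact_cover] is stated for pointed spaces only. *)
Lemma compact_ball_cover E (e : K -> R) : compact E -> (forall x, E x -> 0 < e x) ->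
  exists2 s : seq K, {in s, forall x, E x} &
    E `<=` [set y | exists2 x, x \in s & mdist x y < e x].
Proof.
move=> /compact_near_coveringP cE e0.
(* Finite lists in [E], directed by inclusion: covering a point persists in larger lists, so
   compactness yields one list that covers [E]. *)
pose F : set_system (seq K) := filter_from [set s : seq K | {in s, forall x, E x}]
  (fun s => [set s' | {in s', forall x, E x} /\ {subset s <= s'}]).
have FF : Filter F.
  apply: filter_from_filter; first by exists [::].
  move=> s1 s2 /= s1E s2E; exists (s1 ++ s2).
    by move=> x; rewrite mem_cat => /orP[]; [exact: s1E|exact: s2E].
  by move=> s' [s'E ss']; split; split => // x xs; apply: ss'; rewrite mem_cat xs ?orbT.
have [|s sE sP] := cE _ F (fun s y => exists2 x, x \in s & mdist x y < e x) FF.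
  move=> x Ex; exists (ball x (e x), [set s | x \in s]) => /=.
    split; first by apply: nbhsx_ballx; exact: e0.
    exists [:: x] => [y|s [_ xs]]; last by apply: xs; exact: mem_head.
    by rewrite inE => /eqP ->.
  by move=> [y s] /= [+ xs]; rewrite ballEmdist; exists x.
by exists s => // y; apply: (sP s); split.
Qed.

Lemma compact_net E (e : R) : compact E -> 0 < e ->
  exists2 s : seq K, {in s, forall x, E x} &
    E `<=` [set y | exists2 x, x \in s & mdist x y < e].
Proof. by move=> cE e0; exact: (compact_ball_cover (e := fun=> e)). Qed.

Definition core b B := [set x | B x /\ forall r : R, 0 < r -> ~ sthin b (B `&` ball x r)].

(** Finite 2^-n-nets give countably many balls, and every point of [B] outside the core lies in one
    of them whose trace on [B] is [sthin]. *)
Lemma sthin_setD_core b B : compact [set: K] -> sthin b (B `\` core b B).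
Proof.
move=> cK.
have /choice[s sP] (n : nat) : exists s : seq K,
    forall y : K, exists2 x, x \in s & mdist x y < 2 ^- n.
  have [s _ sP] := compact_net cK (exp2N_gt0 n).
  by exists s => y; exact: sP.
pose V (n i : nat) : set K := if onth (s n) i is Some x then B `&` ball x (2 ^- n) else set0.
pose W n i := if pselect (sthin b (V n i)) then V n i else set0.
have thW : sthin b (\bigcup_n \bigcup_i W n i).
  apply: sthin_bigcup => n; apply: sthin_bigcup => i; rewrite /W; case: pselect => [//|nth] /=.
  apply: thin_sthin; exists 0 => k [|x s'] _ s0 _; first exact: powR_ge0.
  by have := s0 x; rewrite mem_head => /(_ isT).
apply: sub_sthin thW => y [By ncy].
have [r r0 thr] : exists2 r : R, 0 < r & sthin b (B `&` ball y r).
  by apply: contrapT => nr; apply: ncy; split => // r r0 thr; apply: nr; exists r.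
have [|N /(_ _ (leqnn _)) Nr] := @exp2N_lt R (r / 2); first by rewrite divr_gt0.
have [x xs xy] := sP N y.
exists N => //; exists (index x (s N)) => //.
have VE : V N (index x (s N)) = B `&` ball x (2 ^- N).
  by rewrite /V onthE (nth_map x) ?index_mem// nth_index.
rewrite /W VE; case: pselect => [th|[]] /=; first by split; rewrite // ballEmdist.
apply: sub_sthin thr; apply: setIS => z; rewrite !ballEmdist/= => xz.
have := metric_triangle y x z; rewrite (metric_sym y x) => *; lra.
Qed.

Lemma core_nonempty b B : compact [set: K] -> ~ sthin b B -> core b B !=set0.
Proof.
move=> cK nB; apply/set0P/eqP => c0; apply: nB.
by have := sthin_setD_core b B cK; rewrite c0 setD0.
Qed.

(** If the core were thin near x, adding back the removed part, which is [sthin], would make [B]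
    itself [sthin] near x. *)
Lemma core_not_thin b B x (r : R) : compact [set: K] -> core b B x -> 0 < r ->
  ~ thin b (core b B `&` ball x r).
Proof.
move=> cK [Bx nx] r0 /thin_sthin th; apply: (nx r r0).
apply: sub_sthin (sthin_setU th (sthin_setD_core b B cK)) => y [By xy].
by have [cy|ncy] := pselect (core b B y); [left|right].
Qed.

End selection.

(** * Compact sets with prescribed packing dimension *)

Section baire.
Context {R : realType} {K : metricType R}.
Implicit Types (D : set K) (t : R).

(** Baire's argument: as closures of thin sets are thin, no [closure (F i)] contains a relatively
    open part of [D]. This gives nested closed balls centred in [D], each avoiding one more
    [F i]. *)
Lemma closure_not_sthin t D : compact [set: K] -> D !=set0 ->
  (forall p (r : R), D p -> 0 < r -> ~ thin t (D `&` ball p r)) -> ~ sthin t (closure D).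
Proof.
move=> cK [p0 Dp0] nD [F [thF DF]].
have /choice[f fP] (ipr : nat * (K * R)) : exists qs : K * R,
    D ipr.2.1 -> 0 < ipr.2.2 -> [/\ D qs.1, 0 < qs.2,
      forall z, mdist qs.1 z <= qs.2 -> mdist ipr.2.1 z <= ipr.2.2 &
      forall z, mdist qs.1 z <= qs.2 -> ~ F ipr.1 z].
  case: ipr => i [p r] /=; case: (pselect (D p /\ 0 < r)) => [[Dp r0]|npr]; last first.
    by exists (p, r) => Dp r0; case: npr.
  have [q [Dq pq] nq] : exists2 q, (D `&` ball p r) q & ~ closure (F i) q.
    apply: contrapT => nq; apply: (nD _ _ Dp r0).
    apply: sub_thin (thin_closure (thF i)) => q Dq; apply: contrapT => Fq.
    by apply: nq; exists q.
  have [e e0 eF] : exists2 e : R, 0 < e & forall z, mdist q z < e -> ~ F i z.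
    apply: contrapT => ne; apply: nq => U /nbhs_ballP[e e0 eU].
    apply: contrapT => nU; apply: ne; exists e => // z qz Fz; apply: nU.
    by exists z; split => //; apply: eU; rewrite ballEmdist.
  rewrite ballEmdist/= in pq.
  exists (q, Num.min (e / 2) (r - mdist p q)) => _ _; split => //=.
  - by rewrite lt_min divr_gt0// subr_gt0.
  - move=> z; rewrite le_min => /andP[_ qz].
    by have := metric_triangle p q z; lra.
  - by move=> z; rewrite le_min => /andP[qz _]; apply: eF; lra.
pose g := fix g n := if n is n'.+1 then f (n', g n') else (p0, 1).
have gP n : D (g n).1 /\ 0 < (g n).2.
  by elim: n => //= n [Dn rn]; have [] := fP (n, g n) Dn rn.
have gS n z : mdist (g n.+1).1 z <= (g n.+1).2 ->
    mdist (g n).1 z <= (g n).2 /\ ~ F n z.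
  have [Dn rn] := gP n; have [_ _ h1 h2] := fP (n, g n) Dn rn.
  by move=> z1; split; [exact: h1|exact: h2].
have gle n m z : (n <= m)%N -> mdist (g m).1 z <= (g m).2 -> mdist (g n).1 z <= (g n).2.
  move=> /subnK <-; elim: (m - n)%N => // k IH z1; apply: IH.
  by have [] := gS _ _ z1.
(* A cluster point of the centres lies in all the nested closed balls. *)
have [x [_ clx]] := cK ((fun n => (g n).1) @ \oo) _ filterT.
have xcl : closure D x.
  move=> U Ux; have [|_ [[n _ <-] Un]] := clx (range (fun n => (g n).1)) U _ Ux.
    by exists 0 => // n _; exists n.
  by exists (g n).1; split => //; have [] := gP n.
have xg n : mdist (g n).1 x <= (g n).2.
  rewrite leNgt; apply/negP => nx.
  have e0 : 0 < mdist (g n).1 x - (g n).2 by rewrite subr_gt0.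
  have [|_ [[m nm <-]]] :=
    clx ((fun m => (g m).1) @` [set m | (n <= m)%N]) _ _ (nbhsx_ballx _ _ e0).
    by exists n => // m nm; exists m.
  rewrite ballEmdist/= metric_sym => mx.
  have := gle _ _ (g m).1 nm; rewrite mdistxx => /(_ (ltW (gP m).2)).
  have := metric_triangle (g n).1 (g m).1 x; lra.
have [i _ Fx] := DF _ xcl.
by have [_ []] := gS _ _ (xg i.+1).
Qed.

End baire.

Section limsup.
Context {R : realType}.

Definition is_limsup (T : R^nat) (a : R) : Prop := forall e, 0 < e ->
  (exists N, forall k, (N <= k)%N -> T k < a + e) /\
  (forall N, exists2 k, (N <= k)%N & a - e < T k).

End limsup.

(** * Limit sets of an iterated finite construction *)

Section construction.
Context {R : realType} {K : metricType R}.
Context (Q : set K) (b : R) (G : K -> nat -> R -> seq K) (q0 : K).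
Hypothesis cK : compact [set: K].
Hypothesis Qq0 : Q q0.
Hypothesis GQ : forall p m t, Q p -> t <= b ->
  {in G p m t, forall x, Q x /\ mdist p x < 2 ^- (m + 3)}.
Hypothesis G_few : forall p m t j s, Q p -> t <= b -> (m <= j)%N ->
  {subset s <= G p m t} -> spaced j s -> (size s)%:R <= 2 `^ (j%:R * t) + 1.
Hypothesis G_many : forall p m t, Q p -> t <= b -> exists2 n, (m <= n)%N &
  spaced n (G p m t) /\ 2 `^ (n%:R * t) < (size (G p m t))%:R.

Implicit Types T : R^nat.

Fixpoint level T k : seq K :=
  if k is k'.+1 then
    flatten [seq p :: G p (k'.+1 * size (level T k')) (T k') | p <- level T k']
  else [:: q0].

(** With the factor [k.+1], every n beyond this scale satisfies size (level k) <= n / (k + 1), so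
    the points already present are negligible in the count at n. *)
Definition scale T k := (k.+1 * size (level T k))%N.

Definition limit T := closure (\bigcup_k [set` level T k]).

Lemma level_sub T k l : (k <= l)%N -> {subset level T k <= level T l}.
Proof.
move=> /subnK <-; elim: (l - k)%N => // i IH x /IH xi /=.
by apply/flatten_mapP; exists x => //; rewrite mem_head.
Qed.

Lemma level_gt0 T k : (0 < size (level T k))%N.
Proof.
have : q0 \in level T k by apply: (@level_sub _ 0); rewrite ?mem_head.
by case: level.
Qed.

Lemma scale_ltS T k : (scale T k < scale T k.+1)%N.
Proof.
have sz (f : K -> seq K) s : (size s <= size (flatten [seq p :: f p | p <- s]))%N.
  elim: s => //= a s IH; rewrite ltnS size_cat.
  exact: leq_trans IH (leq_addl _ _).
rewrite /scale; apply: (@leq_trans (k.+2 * size (level T k))).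
  by rewrite ltn_pmul2r ?level_gt0.
by rewrite leq_mul2l sz orbT.
Qed.

Lemma leq_scale T k : (k < scale T k)%N.
Proof. by rewrite /scale leq_pmulr// level_gt0. Qed.

Lemma level_eq T T' k : (forall i, (i < k)%N -> T i = T' i) -> level T k = level T' k.
Proof.
elim: k => //= k IH TT'; rewrite IH => [|i ik]; last by rewrite TT'// ltnW.
by rewrite TT'.
Qed.

Lemma level_limit T k : {in level T k, forall x, limit T x}.
Proof. by move=> x xk; apply: subset_closure; exists k. Qed.

Section bounded.
Variable T : R^nat.
Hypothesis Tb : forall k, T k <= b.

Lemma levelQ k : {in level T k, forall x, Q x}.
Proof.
elim: k => [x /[1!inE] /eqP ->//|k IH x /flatten_mapP[p pk]].
rewrite inE => /predU1P[->|xp]; first exact: IH.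
by have [] := GQ (IH _ pk) (Tb k) xp.
Qed.

(** The step from level k moves points by less than 2^-(scale k + 3), and all later steps together
    by less than 2^-(scale (k+1) + 2), which is no larger. *)
Lemma level_near k l : (k <= l)%N -> {in level T l, forall x,
  exists2 p, p \in level T k & mdist p x < 2 ^- (scale T k).+2}.
Proof.
move=> /subnKC <-; move: (l - k)%N => i; elim: i k => [|i IH] j x xl.
  by exists x; [rewrite -[j]addn0|rewrite mdistxx exp2N_gt0].
have [|p pj px] := IH j.+1 x; first by rewrite addSnnS.
have /flatten_mapP[q qj] := pj.
have e1 : (2 ^- (scale T j.+1).+2 <= 2 ^- (scale T j).+3 :> R).
  by apply: exp2N_le; rewrite !ltnS scale_ltS.
have := @exp2NS R (scale T j).+2; have := @exp2N_gt0 R (scale T j).+3 => e2 e3.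
rewrite inE => /predU1P[pq|pq]; first by subst q; exists p => //; lra.
have [_] := GQ (levelQ qj) (Tb j) pq; rewrite -/(scale T j) addn3 => qp.
by exists q => //; have := metric_triangle q p x; lra.
Qed.

Lemma limit_near k x : limit T x ->
  exists2 p, p \in level T k & mdist p x < 2 ^- (scale T k).+1.
Proof.
move=> /(_ _ (nbhsx_ballx _ _ (exp2N_gt0 (scale T k).+2)))[y [[l _ /= yl]]].
rewrite ballEmdist/= metric_sym => xy.
have e := @exp2NS R (scale T k).+1; have e0 := @exp2N_gt0 R (scale T k).+2.
have [kl|/ltnW lk] := leqP k l.
  have [p pk py] := level_near kl yl; exists p => //.
  by have := metric_triangle p y x; lra.
by exists y; [exact: level_sub yl|lra].
Qed.

Lemma limit_closure : limit T `<=` closure Q.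
Proof. by apply: closure_subset => x [k _] /levelQ. Qed.

End bounded.

Lemma size_flatten_le (f : K -> seq K) (c : R) (l s : seq K) :
  {subset s <= flatten [seq f p | p <- l]} ->
  {in l, forall p, (size [seq x <- s | x \in f p])%:R <= c} ->
  (size s)%:R <= (size l)%:R * c.
Proof.
elim: l s => [|p l IH] s sl lc.
  by case: s sl {lc} => [|x s /(_ x)]; [rewrite mul0r|rewrite mem_head => /(_ isT)].
rewrite -(count_predC (fun x => x \in f p) s) natrD [size (_ :: _)]/=.
rewrite -natr1 mulrDl mul1r addrC.
rewrite lerD//; last by rewrite -size_filter lc// mem_head.
rewrite -size_filter; apply: IH.
  move=> x; rewrite mem_filter => /andP[/= xp /sl]; rewrite mem_cat.
  by rewrite (negbTE xp).
move=> q ql; apply: le_trans (lc q _); last by rewrite inE ql orbT.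
by rewrite ler_nat -filter_predI !size_filter; apply: sub_count => x /andP[].
Qed.

(** Moving the points to level k + 1 costs one scale of separation. Each p of level k then accounts
    for itself and at most 2^((n+1) T_k) + 1 new points, there are at most n / (k + 1) <= 2^(n /
    (k+1)) such p, and X + 2 <= 4 X for X >= 1 gives the constant 2 + b. *)
Lemma limit_spaced T k n s : (forall k, 0 <= T k <= b) ->
  (scale T k <= n < scale T k.+1)%N -> {in s, forall x, limit T x} -> spaced n s ->
  (size s)%:R <= 2 `^ (n%:R / k.+1%:R + n%:R * T k + (2 + b)).
Proof.
move=> Tb /andP[kn nk] sT ss.
have Tb' i : T i <= b by case/andP: (Tb i).
have T0 i : 0 <= T i by case/andP: (Tb i).
have /choice[g gP] x : exists y, x \in s -> y \in level T k.+1 /\ mdist y x < 2 ^- n.+2.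
  case: (boolP (x \in s)) => [xs|_]; last by exists x.
  have [y yk yx] := limit_near Tb' k.+1 (sT _ xs); exists y => _; split => //.
  by apply: lt_le_trans yx _; apply: exp2N_le; rewrite ltnS.
have gs x y : x \in s -> y \in s -> x != y -> 2 ^- n.+1 < mdist (g x) (g y).
  move=> xs ys xy; have [_ gx] := gP _ xs; have [_ gy] := gP _ ys.
  have := ss.2 _ _ xs ys xy; have := @exp2NS R n; have := @exp2NS R n.+1.
  have := metric_triangle x (g x) y; rewrite (metric_sym x (g x)).
  have := metric_triangle (g x) (g y) y; move=> *; lra.
have sgs : spaced n.+1 (map g s).
  split; last first.
    move=> _ _ /mapP[x xs ->] /mapP[y ys ->] gxy; apply: gs => //.
    by apply: contra gxy => /eqP ->.
  rewrite map_inj_in_uniq ?ss.1// => x y xs ys gxy; apply/eqP/negPn/negP => xy.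
  by have := gs _ _ xs ys xy; rewrite gxy mdistxx ltNge ltW ?exp2N_gt0.
have cnt : (size (map g s))%:R <= (size (level T k))%:R * (2 `^ (n.+1%:R * T k) + 2).
  apply: (@size_flatten_le (fun p => p :: G p (scale T k) (T k))) => [_ /mapP[x xs ->]|p pk].
    by have [] := gP _ xs.
  set u := [seq _ <- _ | _].
  have su : spaced n.+1 u.
    apply: (spaced_sub _ _ sgs); first by rewrite filter_uniq//; case: sgs.
    by move=> x; rewrite mem_filter => /andP[].
  have su' : spaced n.+1 [seq x <- u | x != p].
    apply: (spaced_sub _ _ su); first by rewrite filter_uniq//; case: su.
    by move=> x; rewrite mem_filter => /andP[].
  have uG : {subset [seq x <- u | x != p] <= G p (scale T k) (T k)}.
    by move=> x; rewrite !mem_filter inE => /andP[/negbTE -> /andP[]].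
  have H := G_few (levelQ Tb' pk) (Tb' k) (leqW kn) uG su'.
  rewrite -(count_predC (pred1 p) u) natrD -!size_filter.
  rewrite (_ : 2 = 1 + 1)// addrA addrC lerD//.
  by rewrite size_filter count_uniq_mem ?(ler_nat R _ 1) ?leq_b1//; case: su.
have p0 : 1 <= 2 `^ (n.+1%:R * T k) :> R.
  by rewrite -[leLHS](powRr0 2) ler_powR ?ler1n// mulr_ge0.
rewrite size_map in cnt; apply: (le_trans cnt).
rewrite -addrA powRD ?pnatr_eq0 ?implybT//; apply: ler_pM => //.
- have : (size (level T k))%:R <= n%:R / k.+1%:R :> R.
    by rewrite ler_pdivlMr ?ltr0n// -natrM ler_nat mulnC.
  move=> h; apply: le_trans (ler_powR _ h); last by rewrite ler1n.
  by rewrite powR_mulrn// -natrX ler_nat ltnW// ltn_expl.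
- apply: (@le_trans _ _ (2 `^ (n.+1%:R * T k) * 2 `^ 2)); last first.
    rewrite -powRD ?pnatr_eq0 ?implybT// ler_powR ?ler1n//.
    by rewrite -natr1 mulrDl mul1r -addrA lerD2l addrC lerD2l.
  by rewrite powR_mulrn//; move: p0; lra.
Qed.

Lemma scale_bracket T N n : (scale T N <= n)%N ->
  exists2 k, (N <= k)%N & (scale T k <= n < scale T k.+1)%N.
Proof.
move=> Nn; have P0 : exists k, (scale T k <= n)%N by exists N.
have Pb k : (scale T k <= n)%N -> (k <= n)%N.
  by move=> kn; apply: ltnW; apply: leq_trans kn; exact: leq_scale.
case: (ex_maxnP P0 Pb) => k kn kmax; exists k; first exact: kmax.
by rewrite kn ltnNge; apply/negP => /kmax; rewrite ltnn.
Qed.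

Lemma limit_thin T t d N : (forall k, 0 <= T k <= b) -> 0 < d ->
  (forall k, (N <= k)%N -> T k + d <= t) -> thin t (limit T).
Proof.
move=> Tb d0 Tt; have b0 : 0 <= b by case/andP: (Tb 0) => /le_trans/[apply].
(* The two thresholds make n / (k + 1) and 2 + b at most n d / 2 each, so that both errors fit into
   n d. *)
pose M := maxn N (Num.truncn (2 / d)).+1.
exists (maxn (scale T M) (Num.truncn (2 * (2 + b) / d)).+1) => n s.
rewrite geq_max => /andP[Mn dn] sT ss.
have [k Mk kn] := scale_bracket Mn.
apply: (le_trans (limit_spaced Tb kn sT ss)); rewrite ler_powR ?ler1n//.
have Nk : (N <= k)%N by rewrite (leq_trans _ Mk)// leq_maxl.
have kd : 2 / d < k.+1%:R.
  apply: lt_le_trans (truncnS_gt _) _; rewrite ler_nat ltnW// ltnS.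
  by rewrite (leq_trans _ Mk)// leq_maxr.
have nd : 2 * (2 + b) / d < n%:R.
  by apply: lt_le_trans (truncnS_gt _) _; rewrite ler_nat.
have h1 : n%:R / k.+1%:R <= n%:R * (d / 2).
  rewrite ler_wpM2l// -[leRHS]invrK lef_pV2 ?posrE ?ltr0n ?invr_gt0 ?divr_gt0//.
  by rewrite invf_div ltW.
have h2 : 2 + b <= n%:R * (d / 2).
  by move: nd; rewrite ltr_pdivrMr// => nd; lra.
have h3 : n%:R * (T k + d) <= n%:R * t by rewrite ler_wpM2l// Tt.
move: h1 h2 h3; rewrite !mulrDr mulrA.
move: (n%:R * d) (n%:R * T k) (n%:R * t) (n%:R / k.+1%:R) => *; lra.
Qed.

(** A point p of some level belongs to all later ones, and whenever t <= T_l it receives, close by,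
    more than 2^(nt) spaced points for a large n. So no relatively open part of the union of levels
    is [thin t], and Baire's argument applies. *)
Lemma limit_not_sthin T t : (forall k, T k <= b) ->
  (forall N, exists2 k, (N <= k)%N & t <= T k) -> ~ sthin t (limit T).
Proof.
move=> Tb tT; apply: closure_not_sthin => //; first by exists q0, 0; rewrite //= mem_head.
move=> p r [k _ /= pk] r0 [N thN].
have [M /(_ _ (leqnn _)) Mr] := exp2N_lt r0.
have [l] := tT (maxn k (maxn N M)); rewrite !geq_max => /and3P[kl Nl Ml] tl.
have pl := level_sub kl pk; have Qp := levelQ Tb pl.
have [n ln [sn]] := G_many (scale T l) Qp (Tb l).
apply/negP; rewrite -leNgt; apply: le_trans (thN _ _ _ _ sn) _.
- by rewrite (leq_trans Nl)// (leq_trans _ ln)// ltnW// leq_scale.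
- move=> x xp; have [_ px] := GQ Qp (Tb l) xp; split.
    by exists l.+1 => //=; apply/flatten_mapP; exists p; rewrite // inE xp orbT.
  rewrite ballEmdist/=; apply: lt_trans Mr; apply: lt_le_trans px _.
  apply: exp2N_le; rewrite (leq_trans Ml)// (leq_trans _ (leq_addr _ _))//.
  by rewrite ltnW// leq_scale.
- by rewrite ler_powR ?ler1n// ler_wpM2l.
Qed.

Lemma packing_dim_limit T a : (forall k, 0 <= T k <= b) -> is_limsup T a ->
  packing_dim (limit T) = a%:E.
Proof.
move=> Tb Ta; apply/eqP; rewrite eq_le; apply/andP; split.
  apply/lee_addgt0Pr => e e0; rewrite -EFinD; apply: sthin_packing_dim.
  have [|[N NT] _] := Ta (e / 2); first by rewrite divr_gt0.
  apply: thin_sthin; apply: (@limit_thin _ _ (e / 2) N) => //; first by rewrite divr_gt0.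
  by move=> k /NT; lra.
rewrite leNgt; apply/negP => dima.
have [t dimt ta] := lte_EFin_split dima.
apply: (@limit_not_sthin T t) (packing_dim_sthin dimt).
  by move=> k; case/andP: (Tb k).
move=> N; have [|_ /(_ N)[k Nk kt]] := Ta (a - t); first by rewrite subr_gt0.
by exists k => //; lra.
Qed.

(** Level k only reads the first k terms, so both limit sets contain the same level k, which is a
    net of the first one. *)
Lemma limit_close T T' k : (forall i, T i <= b) ->
  (forall i, (i < k)%N -> T i = T' i) ->
  forall x, limit T x -> exists2 y, limit T' y & mdist y x < 2 ^- k.
Proof.
move=> Tb TT' x Tx; have [y yk yx] := limit_near Tb k Tx.
exists y; first by apply: (@level_limit _ k); rewrite -(level_eq TT').
by apply: lt_le_trans yx _; apply: exp2N_le; rewrite ltnW// ltnS ltnW// leq_scale.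
Qed.

End construction.

Lemma limit_family (R : realType) (K : metricType R) (B : set K) (b : R) :
  compact [set: K] -> ~ sthin b B ->
  exists C : R^nat -> set K,
    [/\ forall T, C T !=set0 /\ compact (C T),
        forall T, (forall k, T k <= b) -> C T `<=` closure B,
        forall T T' k, (forall i, T i <= b) -> (forall i, (i < k)%N -> T i = T' i) ->
          forall x, C T x -> exists2 y, C T' y & mdist y x < 2 ^- k &
        forall T a, (forall k, 0 <= T k <= b) -> is_limsup T a -> packing_dim (C T) = a%:E].
Proof.
move=> cK nB.
have [q0 Qq0] := core_nonempty cK nB.
have /choice[G GP] (pmt : K * nat * R) : exists s, core b B pmt.1.1 -> pmt.2 <= b ->
  [/\ {in s, forall x, (core b B `&` ball pmt.1.1 (2 ^- (pmt.1.2 + 3))) x},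
      forall j s', (pmt.1.2 <= j)%N -> {subset s' <= s} -> spaced j s' ->
        (size s')%:R <= 2 `^ (j%:R * pmt.2) + 1 &
      exists2 n, (pmt.1.2 <= n)%N & spaced n s /\ 2 `^ (n%:R * pmt.2) < (size s)%:R].
  case: pmt => [[p m] t] /=; have [[Qp tb]|npt] := pselect (core b B p /\ t <= b).
    have [s sP] := spaced_extract m tb (core_not_thin cK Qp (exp2N_gt0 (m + 3))).
    by exists s.
  by exists [::] => Qp tb; case: npt.
pose G' p m t := G (p, m, t).
have GQ p m t : core b B p -> t <= b ->
    {in G' p m t, forall x, core b B x /\ mdist p x < 2 ^- (m + 3)}.
  by move=> Qp tb x; have [/(_ x) + _ _] := GP (p, m, t) Qp tb; rewrite ballEmdist.
have Gf p m t j s : core b B p -> t <= b -> (m <= j)%N ->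
  {subset s <= G' p m t} -> spaced j s -> (size s)%:R <= 2 `^ (j%:R * t) + 1.
  by move=> Qp tb; have [_ + _] := GP (p, m, t) Qp tb; apply.
have Gm p m t : core b B p -> t <= b -> exists2 n, (m <= n)%N &
  spaced n (G' p m t) /\ 2 `^ (n%:R * t) < (size (G' p m t))%:R.
  by move=> Qp tb; have [_ _] := GP (p, m, t) Qp tb.
exists (limit G' q0); split.
- move=> T; split; first by exists q0; apply: (@level_limit _ _ _ _ _ 0); rewrite mem_head.
  by apply: subclosed_compact cK _ => //; exact: closed_closure.
- move=> T Tb; apply: subset_trans (limit_closure Qq0 GQ Tb) _.
  by apply: closure_subset => x [].
- by move=> T T' k Tb TT' x; exact: (limit_close Qq0 GQ Tb TT').
- by move=> T a Tb Ta; exact: (packing_dim_limit cK Qq0 GQ Gf Gm).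
Qed.

(** * Analytic sets as upper limits along binary sequences *)

Section coding.
Context {R : realType} {P : metricType R} (f : P -> \bar R) (a b : R) (x0 : P).
Hypothesis Pcs : complete_separable P.
Hypothesis fc : continuous f.
Hypothesis fx0 : f x0 = a%:E.
Hypothesis ab : a <= b.

Let S := [set x | (a%:E <= f x <= b%:E)%E].

(** A dense countable set may miss [S], so for each of its points d and each c one picks a point of
    [S] within 2^-c of d, if any. Pairing the index with a free component z repeats each choice
    infinitely often. *)
Lemma recurrent_sequence : exists p : nat -> P, (forall n, S (p n)) /\
  forall x e N, S x -> 0 < e -> exists2 n, (N <= n)%N & mdist (p n) x < e.
Proof.
have [_ [D /countable_injP[h hD] Dd]] := Pcs.
have Sx0 : S x0 by rewrite /S/= fx0 !lee_fin lexx.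
pose near_code (ic : nat * nat) y := exists d, [/\ D d, h d = ic.1 & mdist d y < 2 ^- ic.2].
have /choice[p0 pP] (ic : nat * nat) : exists y, S y /\
    ((exists2 y', S y' & near_code ic y') -> near_code ic y).
  have [[y Sy yic]|n] := pselect (exists2 y, S y & near_code ic y); first by exists y.
  by exists x0; split.
pose p n := if (unpickle n : option (nat * nat)) is Some (k, _) then
  if unpickle k is Some ic then p0 ic else x0 else x0.
exists p; split.
  move=> n; rewrite /p; case: (unpickle n) => [[k _]|//].
  by case: (unpickle k) => [ic|//]; have [] := pP ic.
move=> x e N Sx e0.
have [|c /(_ _ (leqnn _)) ce] := @exp2N_lt R (e / 2); first by rewrite divr_gt0.
have [d [xd Dd']] : exists d, ball x (2 ^- c) d /\ D d.
  have [|d [xd Dd']] := Dd (ball x (2 ^- c))° _ (open_interior _).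
    exists x; apply: nbhsx_ballx; exact: exp2N_gt0.
  by exists d; split => //; exact: interior_subset.
rewrite ballEmdist/= metric_sym in xd.
have [z Nz] := pickle_unbounded (pickle (h d, c)) N.
exists (pickle (pickle (h d, c), z)) => //; rewrite /p !pickleK.
have [_ []] := pP (h d, c); first by exists x => //; exists d.
move=> d' [Dd'' hd' d'p].
have dd' : d' = d by apply: hD; rewrite ?inE.
subst d'; rewrite /= in d'p.
have := metric_triangle (p0 (h d, c)) d x; rewrite (metric_sym _ d).
by lra.
Qed.

Section with_sequence.
Context (p : nat -> P).
Hypothesis pS : forall n, S (p n).
Implicit Types u v : nat -> bool.

Let ones u k := (\sum_(i < k) u i)%N.

(** Only marks up to [k] are tested, so [code u k] depends on finitely many bits and a failure is
    permanent. The modulus counts earlier marks rather than positions, so marks may lie far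
    apart. *)
Let valid u k := forall i j, (i < j <= k)%N -> u i -> u j ->
  mdist (p i) (p j) <= 2 ^- (ones u i).

Definition code u : R^nat := fun k => if u k && `[< valid u k >] then fine (f (p k)) else a.

Lemma fine_S x : S x -> a <= fine (f x) <= b.
Proof.
by rewrite /S/=; case: (f x) => [r| |]; rewrite ?lee_fin// ?leye_eq ?leeNy_eq ?andbF.
Qed.

Lemma S_fine x : S x -> f x = (fine (f x))%:E.
Proof.
by rewrite /S/=; case: (f x) => [r| |]//; rewrite ?leye_eq ?leeNy_eq ?andbF. Qed.

Lemma code_itv u k : a <= code u k <= b.
Proof. by rewrite /code; case: ifP => _; [exact: fine_S|rewrite lexx ab]. Qed.

Lemma code_local u v k : (forall i, (i <= k)%N -> u i = v i) -> code u k = code v k.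
Proof.
suff vv w w' : (forall i, (i <= k)%N -> w i = w' i) -> valid w k -> valid w' k.
  move=> uv; rewrite /code uv//; congr (if _ && _ then _ else _).
  by apply: asbool_equiv_eq; split; apply: vv => // i ik; rewrite uv.
move=> ww' vw i j /andP[ij jk] wi wj.
have -> : ones w' i = ones w i.
  apply: eq_bigr => l _; rewrite ww'// (leq_trans (ltnW (ltn_ord l)))//.
  by rewrite ltnW// (leq_trans ij).
by apply: vw; rewrite ?ij// ww'// ltnW// (leq_trans ij).
Qed.

Let io u := forall N, exists2 k, (N <= k)%N & u k && `[< valid u k >].

Let tends u x := forall e, 0 < e -> exists N, forall k, (N <= k)%N -> u k -> mdist (p k) x < e.

Lemma ones_le u k l : (k <= l)%N -> (ones u k <= ones u l)%N.
Proof.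
move=> /subnK <-; elim: (l - k)%N => // i IH.
by rewrite /ones addSn big_ord_recr/= (leq_trans IH) ?leq_addr.
Qed.

Lemma ones_unbounded u m : (forall N, exists2 k, (N <= k)%N & u k) ->
  exists2 k, u k & (m <= ones u k)%N.
Proof.
move=> ui; elim: m => [|m [k uk mk]]; first by have [k _ uk] := ui 0; exists k.
have [l kl ul] := ui k.+1; exists l => //; apply: leq_trans (ones_le u kl).
by rewrite /ones big_ord_recr/= uk addn1 ltnS.
Qed.

Lemma io_valid u k : io u -> valid u k.
Proof.
move=> /(_ k)[l kl /andP[_ /asboolP vl]] i j /andP[ij jk].
by apply: vl; rewrite ij (leq_trans jk).
Qed.

(** After a mark k preceded by at least m marks, all later marked points are within 2^-m of [p k],
    so the tails along the marks form a Cauchy filter. *)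
Lemma io_tends u : io u -> exists x, tends u x.
Proof.
move=> iou.
have ui N : exists2 k, (N <= k)%N & u k by have [k Nk /andP[]] := iou N; exists k.
pose F : set_system P := filter_from setT 
  (fun N => [set p k | k in [set k | (N <= k)%N /\ u k]]).
have FF : ProperFilter F.
  apply: filter_from_proper; last by move=> N _; have [k Nk uk] := ui N; exists (p k), k.
  apply: filter_from_filter; first by exists 0.
  move=> M N _ _; exists (maxn M N) => // _ [k [+ uk] <-].
  by rewrite geq_max => /andP[Mk Nk]; split; exists k.
have [x Fx] : exists x : P, F --> x.
  apply: Pcs.1; apply: cauchy_exP => e e0.
  have [m me] := exp2N_lt e0.
  have [k uk mk] := ones_unbounded m ui.
  exists (p k); exists k.+1 => // _ [l [kl ul] <-]; rewrite ballEmdist/=.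
  apply: le_lt_trans (me _ mk); apply: (io_valid (k := l)) => //.
  by rewrite kl leqnn.
exists x => e e0; have [N _ NF] := Fx _ (nbhsx_ballx x _ e0).
exists N => k Nk uk; have := NF (p k); rewrite ballEmdist/= metric_sym; apply.
by exists k.
Qed.

(** Along the marks f (p k) tends to f x, so x stays in the closed slice; elsewhere the value is a
    <= f x, which does not raise the upper limit. *)
Lemma tends_limsup u x : io u -> tends u x -> S x /\ is_limsup (code u) (fine (f x)).
Proof.
move=> iou ux.
have nb V : nbhs (f x) V -> exists N, forall k, (N <= k)%N -> u k -> V (f (p k)).
  move=> /fc /nbhs_ballP[e e0 eV]; have [N NV] := ux e e0.
  exists N => k Nk uk; apply: eV; rewrite ballEmdist/= metric_sym; exact: NV.
have Sx : S x.
  apply/andP; split; rewrite leNgt; apply/negP => fx.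
    have [|N Nf] := nb [set y | (y < a%:E)%E].
      by apply: open_nbhs_nbhs; split => //; exact: open_ereal_lt_ereal.
    have [k Nk /andP[uk _]] := iou N; have := Nf _ Nk uk => /=.
    by have /andP[+ _] := pS k; rewrite leNgt => /negbTE ->.
  have [|N Nf] := nb [set y | (b%:E < y)%E].
    by apply: open_nbhs_nbhs; split => //; exact: open_ereal_gt_ereal.
  have [k Nk /andP[uk _]] := iou N; have := Nf _ Nk uk => /=.
  by have /andP[_ +] := pS k; rewrite leNgt => /negbTE ->.
split => // e e0; have fxE := S_fine Sx; split.
  have [|N Nf] := nb [set y | (y < (fine (f x) + e)%:E)%E].
    apply: open_nbhs_nbhs; split => /=; first exact: open_ereal_lt_ereal.
    by rewrite [ltLHS]fxE lte_fin ltrDl.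
  exists N => k Nk; rewrite /code; case: ifP => [/andP[uk _]|_].
    by have := Nf _ Nk uk; rewrite /= (S_fine (pS k)) lte_fin.
  by have /andP[ax _] := fine_S Sx; lra.
move=> M; have [|N Nf] := nb [set y | ((fine (f x) - e)%:E < y)%E].
  apply: open_nbhs_nbhs; split => /=; first exact: open_ereal_gt_ereal.
  by rewrite [ltRHS]fxE lte_fin ltrBlDr ltrDl.
have [k] := iou (maxn M N); rewrite geq_max => /andP[Mk Nk] uvk; exists k => //.
rewrite /code uvk; have /andP[uk _] := uvk.
by have := Nf _ Nk uk; rewrite /= (S_fine (pS k)) lte_fin.
Qed.

(** If valid marks stop occurring, [code u] is eventually a = f x0, still a value of f; this is why
    a slice starts at an element of the range. *)
Lemma code_limsup u : exists2 c, is_limsup (code u) c & range f c%:E.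
Proof.
have [iou|nio] := pselect (io u).
  have [x ux] := io_tends iou; have [Sx lx] := tends_limsup iou ux.
  by exists (fine (f x)) => //; exists x => //; exact: S_fine.
exists a; last by exists x0.
have [N Na] : exists N, forall k, (N <= k)%N -> code u k = a.
  apply: contrapT => nN; apply: nio => N; apply: contrapT => nk; apply: nN.
  exists N => k Nk; rewrite /code; case: ifP => // uk.
  by exfalso; apply: nk; exists k.
move=> e e0; split; first by exists N => k Nk; rewrite Na// ltrDl.
by move=> M; exists (maxn M N); rewrite ?leq_maxl// Na ?leq_maxr// ltrBlDr ltrDl.
Qed.

Hypothesis pd : forall x e N, S x -> 0 < e -> exists2 n, (N <= n)%N & mdist (p n) x < e.

Lemma code_surj c : a <= c <= b -> range f c%:E -> exists u, is_limsup (code u) c.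
Proof.
move=> acb [x _ fx].
have Sx : S x by rewrite /S/= fx !lee_fin.
(* Greedy marking: position k is marked when p k is closer to x than the
   number of earlier marks requires. *)
pose test k n := `[< mdist (p k) x < 2 ^- n.+1 >].
pose cnt := fix cnt k := if k is k'.+1 then (cnt k' + test k' (cnt k'))%N else 0%N.
pose u k := test k (cnt k).
have onesE k : ones u k = cnt k.
  by elim: k => [|k IH]; rewrite /ones ?big_ord0// big_ord_recr/= -/(ones u k) IH.
have uP k : u k -> mdist (p k) x < 2 ^- (ones u k).+1 by rewrite onesE => /asboolP.
(* Marked points i < j are both within 2^-(ones u i + 1) of x, which explains the [n.+1] in
   [test]. *)
have vu k : valid u k.
  move=> i j /andP[ij _] /uP ui /uP uj.
  have := @exp2N_le R (ones u j).+1 (ones u i).+1.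
  rewrite ltnS => /(_ (ones_le u (ltnW ij))); have := @exp2NS R (ones u i).
  have := metric_triangle (p i) x (p j); rewrite (metric_sym x).
  by move=> *; lra.
(* If marking stopped at N, the count would stay [cnt N], yet some later [p k] passes that very
   test. *)
have ui N : exists2 k, (N <= k)%N & u k.
  apply: contrapT => nk.
  have u0 k : (N <= k)%N -> u k = false.
    by move=> Nk; apply/negP => uk; apply: nk; exists k.
  have [k Nk kx] := pd N Sx (@exp2N_gt0 R (cnt N).+1).
  have := u0 _ Nk; rewrite /u; suff -> : cnt k = cnt N by move/asboolPn.
  move: Nk => /subnK <-; elim: (k - N)%N => // i IH.
  by rewrite addSn /= -/(u _) u0 ?addn0 ?leq_addl.
have iou : io u.
  by move=> N; have [k Nk uk] := ui N; exists k => //; rewrite uk; exact/asboolP.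
have ux : tends u x.
  move=> e e0; have [m me] := exp2N_lt e0; have [k uk mk] := ones_unbounded m ui.
  exists k => l kl ul; apply: lt_trans (uP _ ul) (me _ _).
  by rewrite (leq_trans mk)// ltnW// ltnS ones_le.
by exists u; have [_] := tends_limsup iou ux; rewrite fx.
Qed.

End with_sequence.

Lemma coding : exists T : (nat -> bool) -> R^nat,
  [/\ forall u k, a <= T u k <= b,
      forall u v k, (forall i, (i <= k)%N -> u i = v i) -> T u k = T v k,
      forall u, exists2 c, is_limsup (T u) c & range f c%:E &
      forall c, a <= c <= b -> range f c%:E -> exists u, is_limsup (T u) c].
Proof.
have [p [pS pd]] := recurrent_sequence; exists (code p); split.
- exact: code_itv.
- exact: code_local.
- exact: code_limsup.
- exact: code_surj.
Qed.

End coding.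

(** * Compact families of compact sets *)

Section assembly.
Context {R : realType} {K : metricType R}.
Implicit Types (E B : set K) (s : seq K).

Definition to_hyperspace E (h : E !=set0 /\ compact E) : hyperspace K :=
  exist _ E (mem_set h).

Lemma hyperspace_mdist_le (A B : hyperspace K) (e : R) : 0 < e ->
  (forall x, set_val A x -> exists2 y, set_val B y & mdist y x < e) ->
  (forall y, set_val B y -> exists2 x, set_val A x & mdist x y < e) ->
  mdist A B <= e.
Proof.
move=> e0 AB BA; apply: ge_inf; first by exists 0; exact: hausdorff_radii_lb.
split => // x; first by move=> /AB[y By yx]; exists y; rewrite // ballEmdist.
by move=> /BA[y By yx]; exists y; rewrite // ballEmdist.
Qed.

Lemma packing_dim_setU_seq E s (c : R) : 0 <= c -> packing_dim E = c%:E ->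
  packing_dim (E `|` [set` s]) = c%:E.
Proof.
move=> c0 Ec; apply/eqP; rewrite eq_le; apply/andP; split.
  apply/lee_addgt0Pr => e e0; rewrite -EFinD; apply: sthin_packing_dim.
  apply: sthin_setU; last by apply: sthin_seq; rewrite addr_ge0// ltW.
  by apply: packing_dim_sthin; rewrite Ec lte_fin ltrDl.
rewrite leNgt; apply/negP => /lte_EFin_split[t dt]; apply/negP; rewrite -leNgt.
rewrite -lee_fin -Ec; apply: sthin_packing_dim.
by apply: sub_sthin (packing_dim_sthin dt); exact: subsetUl.
Qed.

Lemma compact_set_seq s : compact [set x : K | x \in s].
Proof.
elim: s => [|x s IH].
  have -> : [set x : K | x \in [::]] = set0 by apply/seteqP; split.
  exact: compact0.
have -> : [set y : K | y \in x :: s] = [set x] `|` [set` s].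
  by apply/seteqP; split => y /=; rewrite inE => /predU1P.
by apply: compactU IH; exact: compact_set1.
Qed.

Lemma nbhs_prefix (u : cantor_space) k :
  nbhs u [set v : cantor_space | forall i, (i < k)%N -> u i = v i].
Proof.
elim: k => [|k IH].
  by apply: (@filterS _ _ _ setT); [move=> v _ i; rewrite ltn0|exact: filterT].
have uk : nbhs u [set v : cantor_space | v k = u k].
  exact: (@proj_continuous nat (fun=> bool) k u [set u k] (discrete_set1 _)).
apply: filterS (filterI IH uk) => v [uv vk] i.
by rewrite ltnS leq_eqVlt => /predU1P[->|]; [rewrite vk|exact: uv].
Qed.

(** The family is a continuous image of the Cantor space: bits agreeing below k give sets at
    Hausdorff distance at most 2^-k. The common part [s] later steers such families towards one
    limit set. *)
Lemma slice_family (P : metricType R) (f : P -> \bar R) (a b : R) B s :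
  compact [set: K] -> ~ sthin b B -> complete_separable P -> continuous f ->
  range f a%:E -> 0 <= a <= b ->
  exists CC : set (hyperspace K),
  [/\ compact CC,
      forall X, CC X -> [set` s] `<=` set_val X /\ set_val X `<=` closure B `|` [set` s],
      forall X, CC X -> exists2 c, packing_dim (set_val X : set K) = c%:E & range f c%:E &
      forall c, a <= c <= b -> range f c%:E ->
        exists2 X, CC X & packing_dim (set_val X : set K) = c%:E].
Proof.
move=> cK nB Pcs fc [x0 _ fx0] /andP[a0 ab].
have [T [Tab Tloc Tlim Tsurj]] := coding Pcs fc fx0 ab.
have [C [Cc CB Cclose Cdim]] := limit_family cK nB.
have T0b u k : 0 <= T u k <= b.
  by have /andP[aT ->] := Tab u k; rewrite (le_trans a0).
have Tb u k : T u k <= b by case/andP: (T0b u k).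
have Cs u : C (T u) `|` [set` s] !=set0 /\ compact (C (T u) `|` [set` s]).
  have [[x Cx] Ccpt] := Cc (T u); split; first by exists x; left.
  exact/compactU/compact_set_seq.
pose Phi (u : cantor_space) : hyperspace K := to_hyperspace (Cs u).
have Phidim u c : is_limsup (T u) c -> packing_dim (set_val (Phi u) : set K) = c%:E.
  move=> Tc; apply: packing_dim_setU_seq; last exact: Cdim.
  rewrite leNgt; apply/negP => c0; have [|[N /(_ _ (leqnn _)) Nc] _] := Tc (- c).
    by rewrite oppr_gt0.
  by move: Nc; rewrite subrr ltNge; have /andP[->] := T0b u N.
have Phic : continuous Phi.
  move=> u V /nbhs_ballP[e /= e0 eV].
  have [|k /(_ _ (leqnn _)) ke] := @exp2N_lt R e; first by [].
  apply: (filterS _ (nbhs_prefix u k)) => v pre; apply: eV.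
  rewrite ballEmdist/=; apply: le_lt_trans ke.
  have uv i : (i < k)%N -> T u i = T v i.
    move=> ik; apply: Tloc => j ji; apply: pre; exact: leq_ltn_trans ik.
  apply: hyperspace_mdist_le; first exact: exp2N_gt0.
    move=> x [Cx|sx]; last by exists x; [right|rewrite mdistxx exp2N_gt0].
    have [y Cy yx] := Cclose _ _ k (Tb u) uv _ Cx; exists y => //; by left.
  move=> x [Cx|sx]; last by exists x; [right|rewrite mdistxx exp2N_gt0].
  have [y Cy yx] := Cclose _ _ k (Tb v) (fun i ik => esym (uv i ik)) _ Cx.
  by exists y => //; left.
exists (range Phi); split.
- apply: continuous_compact cantor_space_compact.
  exact: continuous_subspaceT.
- move=> _ [u _ <-]; split; first by move=> x sx; right.
  by move=> x [/(CB _ (Tb u))|sx]; [left|right].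
- move=> _ [u _ <-]; have [c Tc fc'] := Tlim u; exists c => //; exact: Phidim.
- move=> c acb fc'; have [u Tc] := Tsurj c acb fc'.
  by exists (Phi u); [exists u|exact: Phidim].
Qed.

(** A filter on the union that does not cluster at x contains a set missing a ball about x, hence
    lives on finitely many [F n], whose union is compact. *)
Lemma compact_converging_union (X : metricType R) (x : X) (F : (set X)^nat) :
  (forall n, compact (F n)) ->
  (forall e : R, 0 < e -> exists N, forall n, (N <= n)%N ->
    forall z, F n z -> mdist x z < e) ->
  compact ([set x] `|` \bigcup_n F n).
Proof.
move=> Fc Fx G GG GF.
have [clx|] := pselect (cluster G x); first by exists x; split => //; left.
move=> /existsNP[U /existsNP[V /not_implyP[GU /not_implyP[Vx UV]]]].
move: Vx => /nbhs_ballP[e /= e0 eV]; have [N FN] := Fx e e0.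
have [z [Fz cz]] : (\big[setU/set0]_(n < N) F n) `&` cluster G !=set0.
  apply: bigsetU_compact => //; apply: filterS (filterI GF GU) => z [xFz Uz].
  have nVz : ~ ball x e z by move=> /eV Vz; apply: UV; exists z.
  rewrite -bigcup_mkord; case: xFz => [zx|[n _ Fz]].
    by case: nVz; rewrite zx; exact: ballxx.
  have nN : (n < N)%N.
    by rewrite ltnNge; apply/negP => /FN/(_ _ Fz); move: nVz; rewrite ballEmdist.
  by exists n.
exists z; split => //; right.
by move: Fz; rewrite -bigcup_mkord => -[n _ Fz]; exists n.
Qed.

(** Without a minimum, choose for each rational q an element of [S] below q if there is one; some q
    lies between any x in [S] and a smaller element. *)
Lemma coinitial_sequence (S : set R) : S !=set0 ->
  exists a : nat -> R, (forall n, S (a n)) /\ forall x, S x -> exists n, a n <= x.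
Proof.
move=> [x0 Sx0].
have [[m Sm mS]|nmin] := pselect (exists2 m, S m & forall x, S x -> m <= x).
  by exists (fun=> m); split => // x Sx; exists 0; exact: mS.
have /choice[a aP] (q : rat) : exists y,
    S y /\ ((exists2 z, S z & z <= ratr q) -> y <= ratr q).
  have [[z Sz zq]|nz] := pselect (exists2 z, S z & z <= ratr q); first by exists z.
  by exists x0.
exists (fun n => if unpickle n is Some q then a q else x0); split.
  by move=> n; case: (unpickle n) => [q|//]; have [] := aP q.
move=> x Sx; have [y Sy yx] : exists2 y, S y & y < x.
  apply: contrapT => ny; apply: nmin; exists x => // y Sy.
  by rewrite leNgt; apply/negP => yx; apply: ny; exists y.
have [q /andP[yq qx]] := rat_in_itvoo yx; exists (pickle q); rewrite pickleK.
have [_ aq] := aP q; apply: le_trans (ltW qx); apply: aq; exists y => //.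
exact: ltW.
Qed.

Lemma cofinal_sequence (S : set R) : S !=set0 ->
  exists b : nat -> R, (forall n, S (b n)) /\ forall x, S x -> exists n, x <= b n.
Proof.
move=> [x0 Sx0]; have [|a [Sa aS]] := @coinitial_sequence [set x | S (- x)].
  by exists (- x0); rewrite /= opprK.
exists (fun n => - a n); split => // x Sx.
have [|n ax] := aS (- x); first by rewrite /= opprK.
by exists n; rewrite lerNr.
Qed.

Lemma slice_sequence (S : set R) : S !=set0 ->
  exists a b : nat -> R, [/\ forall n, S (a n), forall n, S (b n), forall n, a n <= b n &
    forall x, S x -> exists n, a n <= x <= b n].
Proof.
move=> S0; have [a [Sa aS]] := coinitial_sequence S0.
have [b [Sb bS]] := cofinal_sequence S0.
pose ij n := if unpickle n is Some ij then ij else (0%N, 0%N).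
(* The maximum keeps the right end in [S] and above the left one, and only enlarges the interval. *)
exists (fun n => a (ij n).1), (fun n => Num.max (a (ij n).1) (b (ij n).2)); split => //.
- by move=> n; case: leP.
- by move=> n; rewrite le_max lexx.
- move=> x Sx; have [i ax] := aS x Sx; have [j xb] := bS x Sx.
  by exists (pickle (i, j)); rewrite /ij pickleK/= ax le_max xb orbT.
Qed.

(** Otherwise each point has a ball that is [sthin c] for some c < dim_P K; finitely many balls
    cover K, and the largest c contradicts the dimension. *)
Lemma full_point (c0 : R) : compact [set: K] -> (c0%:E < packing_dim [set: K])%E ->
  exists y : K, forall c r : R, (c%:E < packing_dim [set: K])%E -> 0 < r ->
    ~ sthin c (ball y r).
Proof.
move=> cK c0d; apply: contrapT => ny.
have /choice[cr crP] (y : K) : exists cr : R * R,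
    [/\ (cr.1%:E < packing_dim [set: K])%E, 0 < cr.2 & sthin cr.1 (ball y cr.2)].
  apply: contrapT => ncr; apply: ny; exists y => c r cd r0 th.
  by apply: ncr; exists (c, r).
have [|s _ sK] := @compact_ball_cover _ _ _ (fun y => (cr y).2) cK.
  by move=> y _; have [] := crP y.
have [c cd cs] : exists2 c : R,
    (c%:E < packing_dim [set: K])%E & {in s, forall y, (cr y).1 <= c}.
  elim: s {sK} => [|y s [c cd cs]]; first by exists c0.
  exists (Num.max (cr y).1 c); first by have [crd _ _] := crP y; case: (leP (cr y).1 c).
  move=> z /[1!inE] /predU1P[->|/cs zc]; first by rewrite le_max lexx.
  by rewrite le_max zc orbT.
suff /sthin_packing_dim : sthin c [set: K] by rewrite leNgt cd.
have : sthin c (\bigcup_i (if onth s i is Some y then ball y (cr y).2 else set0)).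
  apply: sthin_bigcup => i; case E : (onth s i) => [y|].
    have [_ _ +] := crP y; apply: sthin_le; apply: cs.
    by apply/onthP; exists i.
  by apply: thin_sthin; exists 0 => k [|x s'] _ s0 _; [exact: powR_ge0|
    have := s0 x; rewrite mem_head => /(_ isT)].
apply: sub_sthin => x _; have [y ys yx] := sK x I.
exists (index y s) => //=; rewrite onthE (nth_map y) ?index_mem// nth_index//.
by rewrite ballEmdist.
Qed.

Lemma closure_ball_sub (y x : K) (r : R) : closure (ball y r) x -> mdist y x <= r.
Proof.
move=> cx; rewrite leNgt; apply/negP => rx.
have [|z []] := cx (ball x (mdist y x - r)); first by apply: nbhsx_ballx; rewrite subr_gt0.
rewrite !ballEmdist/= => yz xz.
by have := metric_triangle y z x; rewrite (metric_sym z); lra.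
Qed.

Lemma packing_dims_below (P : metricType R) (f : P -> \bar R) (c0 : R) :
  compact [set: K] -> complete_separable P -> continuous f ->
  (forall z, (0 <= f z)%E) -> range f c0%:E -> (c0%:E < packing_dim [set: K])%E ->
  exists CC : set (hyperspace K),
    [/\ compact CC,
        forall X, CC X -> range f (packing_dim (set_val X : set K)) &
        forall c : R, range f c%:E -> (c%:E < packing_dim [set: K])%E ->
          exists2 X, CC X & packing_dim (set_val X : set K) = c%:E].
Proof.
move=> cK Pcs fc f0 fc0 c0d.
have [y yfull] := full_point cK c0d.
pose S : set R := [set c | range f c%:E /\ (c%:E < packing_dim [set: K])%E].
have [a [b [Sa Sb ab abS]]] := @slice_sequence S (ex_intro _ c0 (conj fc0 c0d)).
have ge0 c : range f c%:E -> 0 <= c by move=> [z _ fz]; rewrite -lee_fin -fz.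
have slice n s := @slice_family _ f (a n) (b n) (ball y (2 ^- n)) s cK
  (yfull _ _ (Sb n).2 (exp2N_gt0 n)) Pcs fc (Sa n).1.
have a0b n : 0 <= a n <= b n by rewrite ab andbT; exact: ge0 (Sa n).1.
(* A slice with the empty list serves only to provide one compact set [D0] of dimension [a 0]. *)
have [CC0 [_ _ CC0f CC0c]] := slice 0 [::] (a0b 0).
have [|D0 CD0 dD0] := CC0c (a 0) _ (Sa 0).1; first by rewrite lexx ab.
have [D0n D0c] := hyperspaceP D0.
have Dh : set_val D0 `|` [set` [:: y]] !=set0 /\ compact (set_val D0 `|` [set` [:: y]]).
  split; first by case: D0n => x Dx; exists x; left.
  exact/compactU/compact_set_seq.
pose D := to_hyperspace Dh.
have Dy : set_val D y by right; rewrite /= mem_head.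
have /choice[s sP] (n : nat) : exists s : seq K, {in s, forall x, (set_val D0 : set K) x} /\
    (set_val D0 : set K) `<=` [set y | exists2 x, x \in s & mdist x y < 2 ^- n].
  by have [s h1 h2] := compact_net D0c (exp2N_gt0 n); exists s.
have /choice[F FP] n := slice n (y :: s n) (a0b n).
exists ([set D] `|` \bigcup_n F n); split.
- apply: compact_converging_union => [n|e e0]; first by have [] := FP n.
  have [N Ne] : exists N, forall n, (N <= n)%N -> 2 ^- n < e / 2.
    by apply: exp2N_lt; rewrite divr_gt0.
  exists N => n Nn X FX; have [_ /(_ X FX)[sX Xs] _ _] := FP n.
  have [sD Dsn] := sP n; have n0 := @exp2N_gt0 R n; have ne := Ne n Nn.
  (* Points in the closure of the ball are within 2^-n of y, possibly with equality, while
     [hyperspace_mdist_le] asks for strict inequalities; hence the doubled bound. *)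
  apply: (@le_lt_trans _ _ (2 ^- n + 2 ^- n)); last by lra.
  apply: hyperspace_mdist_le; first by lra.
    move=> x [Dx|/=].
      have [z zs zx] := Dsn x Dx; exists z; last by lra.
      by apply: sX; rewrite /= inE zs orbT.
    rewrite inE => /eqP ->; exists y; last by rewrite mdistxx; lra.
    by apply: sX; rewrite /= mem_head.
  move=> x /Xs[/closure_ball_sub yx|/=]; first by exists y => //; lra.
  rewrite inE => /predU1P[->|xs]; first by exists y => //; rewrite mdistxx; lra.
  by exists x; [left; exact: sD|rewrite mdistxx; lra].
- move=> X [->|[n _ FX]].
    rewrite (_ : packing_dim _ = (a 0)%:E); first exact: (Sa 0).1.
    by apply: packing_dim_setU_seq => //; case/andP: (a0b 0).
  by have [_ _ /(_ X FX)[c -> fc'] _] := FP n.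
- move=> c fc' cd; have [n abc] := abS c (conj fc' cd).
  have [_ _ _ /(_ c abc fc')[X FX dX]] := FP n.
  by exists X => //; right; exists n.
Qed.

End assembly.

Theorem theorem4p8 (R : realType) (K : metricType R) (A : set (\bar R)) :
  [set: K] !=set0 ->
  compact [set: K] ->
  A `<=` `[0%E, packing_dim [set: K]] ->
  analytic R A ->
  exists CC : set (hyperspace K),
    compact CC /\ [set packing_dim (set_val C : set K) | C in CC] = A.
Proof.
move=> K0 cK A0d [P [f [Pcs fc fA]]]; set d := packing_dim _ in A0d.
have A_ge0 x : A x -> (0 <= x)%E by move=> /A0d; rewrite /= in_itv/= => /andP[].
have A_led x : A x -> (x <= d)%E by move=> /A0d; rewrite /= in_itv/= => /andP[].
pose Kh := to_hyperspace (conj K0 cK).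
(* The value dim_P K is treated apart: slices need a bound strictly below it, and it may be
   infinite. *)
pose top := [set X : hyperspace K | X = Kh /\ A d].
have top_compact : compact top.
  have [Ad|nAd] := pselect (A d).
    have -> : top = [set Kh] by apply/seteqP; split => [X []|X ->].
    exact: compact_set1.
  have -> : top = set0 by apply/seteqP; split => [X []|X []].
  exact: compact0.
have [CC [CCc CCA CCs]] : exists CC : set (hyperspace K), [/\ compact CC,
    forall X, CC X -> A (packing_dim (set_val X : set K)) &
    forall c : R, A c%:E -> (c%:E < d)%E ->
      exists2 X, CC X & packing_dim (set_val X : set K) = c%:E].
  (* If no real element of [A] lies below dim_P K, there is no slice and the empty family
     suffices. *)
  have [[c0 Ac0 c0d]|nc] := pselect (exists2 c : R, A c%:E & (c%:E < d)%E).
    rewrite -fA; apply: (@packing_dims_below _ _ _ _ c0) => //; rewrite ?fA//.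
    by move=> z; apply: A_ge0; rewrite -fA; exists z.
  exists set0; split => //; first exact: compact0.
  by move=> c Ac cd; exfalso; apply: nc; exists c.
exists (CC `|` top); split; first exact: compactU.
apply/seteqP; split => [_ [X [CX|[-> Ad]] <-]//|x Ax]; first exact: CCA.
have := A_led _ Ax; rewrite le_eqVlt => /predU1P[xd|xd].
  by exists Kh; [right; rewrite /top/= -xd|rewrite xd].
have [c cx] : exists c : R, x = c%:E.
  case: x Ax xd => [c _ _|_|/A_ge0]; [by exists c| |by rewrite leeNy_eq].
  by rewrite ltNge leey.
subst x; have [X CX dX] := CCs c Ax xd.
by exists X => //; left.
Qed.
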